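(* Let $p$ be a prime and let $m\ge 0$ be an integer. Let $A$ be a finitely generated group, $B$ a finitely presented group, and $\phi:A\to B$ a homomorphism. Suppose that $\phi$ induces an isomorphism (respectively, a monomorphism) $H_1(A;\mathbb{Z}_p)\to H_1(B;\mathbb{Z}_p)$ and that the composite $H_2(A;\mathbb{Z}_p)\xrightarrow{\phi_*}H_2(B;\mathbb{Z}_p)\to H_2(B;\mathbb{Z}_p)/\Phi^{(m)}(B)$ is an epimorphism. Then for any $n\le m+1$, $\phi$ induces an isomorphism (respectively, a monomorphism) $A/A^{(n)}\to B/B^{(n)}$.
   Context: $\mathbb{Z}_p$ denotes the integers modulo $p$. For a group $G$, the derived $p$-series $\{G^{(n)}\}_{n\ge 0}$ is defined by $G^{(0)}=G$ and $G^{(n+1)}=[G^{(n)},G^{(n)}](G^{(n)})^p$, i.e. the subgroup generated by commutators and $p$-th powers of elements of $G^{(n)}$ (the prime $p$ is suppressed from the notation). For a group $B$, $\Phi^{(m)}(B)\subset H_2(B;\mathbb{Z}_p)$ denotes the image of the inclusion-induced map $H_2(B^{(m)};\mathbb{Z}_p)\to H_2(B;\mathbb{Z}_p)$. *)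

(* Defs.v *)
From HB Require Import structures.
From mathcomp Require Import all_boot all_algebra.
From mathcomp Require Import boolp finmap.
From mathcomp Require Import monalg.

Set Implicit Arguments.
Unset Strict Implicit.
Unset Printing Implicit Defensive.

Import GRing.Theory.

Local Open Scope group_scope.

Notation "{ 'ghom' G -> H }" := (UMagmaMorphism.type G%type H%type)
  (at level 0, G at level 98, H at level 99, format "{ 'ghom'  G  ->  H }")
  : type_scope.

Section GeneratedSubgroup.
Variable G : groupType.

(* The smallest subgroup containing S: the intersection of all of them. *)
Definition gen (S : G -> Prop) : {pred G} := fun x =>
  `[< forall H : groupClosed G, (forall y, S y -> y \in H) -> x \in H >].

Lemma genP (S : G -> Prop) x : reflect
  (forall H : groupClosed G, (forall y, S y -> y \in H) -> x \in H)
  (x \in gen S).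
Proof. exact: asboolP. Qed.

Lemma mem_gen (S : G -> Prop) x : S x -> x \in gen S.
Proof. by move=> Sx; apply/genP => H; apply. Qed.

Fact gen_mulg_closed S : mulg_closed (gen S).
Proof.
by move=> x y /genP xS /genP yS; apply/genP => H SH; rewrite gpredM ?xS ?yS.
Qed.
Fact gen_mem1 S : 1 \in gen S.
Proof. by apply/genP => H _; rewrite gpred1. Qed.
Fact gen_invg_closed S : invg_closed (gen S).
Proof. by move=> x /genP xS; apply/genP => H SH; rewrite gpredV xS. Qed.

HB.instance Definition _ S := isMulClosed.Build G (gen S) (@gen_mulg_closed S).
HB.instance Definition _ S := isMul1Closed.Build G (gen S) (@gen_mem1 S).
HB.instance Definition _ S := isInvClosed.Build G (gen S) (@gen_invg_closed S).

End GeneratedSubgroup.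

HB.mixin Record isConjClosed (G : groupType) (N : {pred G}) := {
  gpredJ : forall x y : G, x \in N -> x ^ y \in N
}.

#[short(type="normalClosed")]
HB.structure Definition NormalClosed (G : groupType) :=
  {N of GroupClosed G N & isConjClosed G N}.

Section Preimage.
Variables (G H : groupType) (f : {ghom G -> H}) (K : groupClosed H).

Definition preim_pred : {pred G} := fun x => f x \in K.

Lemma in_preim_pred x : (x \in preim_pred) = (f x \in K). Proof. by []. Qed.

Fact preim_mulg_closed : mulg_closed preim_pred.
Proof. by move=> x y xS yS; rewrite in_preim_pred gmulfM gpredM. Qed.
Fact preim_mem1 : 1 \in preim_pred.
Proof. by rewrite in_preim_pred gmulf1 gpred1. Qed.
Fact preim_invg_closed : invg_closed preim_pred.
Proof. by move=> x; rewrite !in_preim_pred gmulfV gpredV. Qed.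

HB.instance Definition _ := isMulClosed.Build G preim_pred preim_mulg_closed.
HB.instance Definition _ := isMul1Closed.Build G preim_pred preim_mem1.
HB.instance Definition _ := isInvClosed.Build G preim_pred preim_invg_closed.
End Preimage.

Lemma gen_morph (G H : groupType) (f : {ghom G -> H})
    (S : G -> Prop) (T : H -> Prop) :
  (forall x, S x -> T (f x)) -> forall x, x \in gen S -> f x \in gen T.
Proof.
move=> ST x /genP xS; rewrite -in_preim_pred; apply: xS => z Sz.
by rewrite in_preim_pred; apply/mem_gen/ST.
Qed.

Definition conj_by (G : groupType) (y x : G) := x ^ y.
HB.instance Definition _ (G : groupType) (y : G) :=
  isUMagmaMorphism.Build G G (conj_by y) (conj1g y, fun u v => conjMg u v y).

Lemma gen_conj (G : groupType) (S : G -> Prop) :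
  (forall x y, S x -> S (x ^ y)) -> forall x y, x \in gen S -> x ^ y \in gen S.
Proof.
by move=> SJ x y; apply: (gen_morph (f := conj_by y)) => z; apply: SJ.
Qed.

Module QuotientGroup.
Section QuotientGroup.
Variables (G : groupType) (N : normalClosed G).
Local Open Scope quotient_scope.

Definition equiv (x y : G) := x^-1 * y \in N.

Fact equiv_is_equiv : equiv_class_of equiv.
Proof.
split=> [x|x y|y x z]; rewrite /equiv; first by rewrite mulVg gpred1.
  by rewrite -gpredV invgM invgK.
by move=> xy yz; rewrite -(mulVKg y z) mulgA gpredM.
Qed.

Canonical equiv_equiv := EquivRelPack equiv_is_equiv.
Canonical equiv_encModRel := defaultEncModRel equiv.

Definition quot := {eq_quot equiv}.

#[export] HB.instance Definition _ := EqQuotient.on quot.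
#[export] HB.instance Definition _ := Choice.on quot.

Lemma eqP (x y : G) : reflect (\pi_quot x = \pi_quot y) (x^-1 * y \in N).
Proof. exact: eqquotP. Qed.

Definition mul := lift_op2 quot (fun x y => x * y).
Definition one : quot := lift_cst quot 1.
Definition inv := lift_op1 quot (fun x => x^-1).

Lemma repr_pi (x : G) : exists2 u, u \in N & repr (\pi_quot x) = x * u.
Proof.
exists (x^-1 * repr (\pi_quot x)); last by rewrite mulVKg.
by apply/eqP; rewrite reprK.
Qed.

Lemma pi_one : \pi_quot 1 = one. Proof. by unlock one. Qed.

Lemma pi_mul (x y : G) : \pi_quot (x * y) = mul (\pi_quot x) (\pi_quot y).
Proof.
unlock mul; apply/eqP.
have [u uN ->] := repr_pi x; have [v vN ->] := repr_pi y.
have -> : (x * y)^-1 * (x * u * (y * v)) = u ^ y * v.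
  by rewrite invgM conjgE !mulgA mulgVK.
by rewrite gpredM ?gpredJ.
Qed.

Lemma pi_inv (x : G) : \pi_quot x^-1 = inv (\pi_quot x).
Proof.
unlock inv; apply/eqP; have [u uN ->] := repr_pi x.
have -> : x^-1^-1 * (x * u)^-1 = u^-1 ^ x^-1 by rewrite invgM conjgE.
by rewrite gpredJ ?gpredV.
Qed.

Fact mulA : associative mul.
Proof.
by move=> x y z; rewrite -[x]reprK -[y]reprK -[z]reprK -!pi_mul mulgA.
Qed.
Fact mul1 : left_id one mul.
Proof. by move=> x; rewrite -[x]reprK -pi_one -pi_mul mul1g. Qed.
Fact mulr1 : right_id one mul.
Proof. by move=> x; rewrite -[x]reprK -pi_one -pi_mul mulg1. Qed.
Fact mulV : left_inverse one inv mul.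
Proof. by move=> x; rewrite -[x]reprK -pi_one -pi_inv -pi_mul mulVg. Qed.
Fact mulrV : right_inverse one inv mul.
Proof. by move=> x; rewrite -[x]reprK -pi_one -pi_inv -pi_mul mulgV. Qed.

#[export] HB.instance Definition _ :=
  isGroup.Build quot mulA mul1 mulr1 mulV mulrV.

Lemma piM : {morph \pi_quot : x y / x * y}.
Proof. exact: pi_mul. Qed.

End QuotientGroup.
Module Exports. HB.reexport. End Exports.
End QuotientGroup.
Export QuotientGroup.Exports.

Notation quot_group := QuotientGroup.quot.

Section QuotientMap.
Variables (G H : groupType) (M : normalClosed G) (N : normalClosed H).
Variable f : {ghom G -> H}.
Local Open Scope quotient_scope.

(* The map G / M -> H / N induced by f; meaningful when f maps M into N. *)
Definition quot_map (x : quot_group M) : quot_group N := \pi_(quot_group N) (f (repr x)).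

Hypothesis fMN : forall x, x \in M -> f x \in N.

Lemma quot_mapE x : quot_map (\pi_(quot_group M) x) = \pi_(quot_group N) (f x).
Proof.
rewrite /quot_map; have [u uM ->] := QuotientGroup.repr_pi M x.
apply/esym/QuotientGroup.eqP; rewrite gmulfM mulKg; exact: fMN.
Qed.

Lemma quot_mapM : {morph quot_map : x y / x * y}.
Proof.
move=> x y; rewrite -[x]reprK -[y]reprK -QuotientGroup.piM.
by rewrite !quot_mapE gmulfM QuotientGroup.piM.
Qed.
End QuotientMap.

Arguments quot_map {G H M N} f x.

Section DerivedPSeries.
Variables (p : nat) (G : groupType).

Fixpoint derived_pseries (n : nat) : {pred G} :=
  if n is k.+1 then
    gen (fun z =>
      (exists x y : G, [/\ x \in derived_pseries k, y \in derived_pseries k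
                         & z = [~ x, y]])
      \/ (exists2 x : G, x \in derived_pseries k & z = x ^+ p))
  else predT.

Fact derived_pseries_mulg n : mulg_closed (derived_pseries n).
Proof. by case: n => //= n x y; apply: gpredM. Qed.
Fact derived_pseries_1 n : 1 \in derived_pseries n.
Proof. by case: n => //= n; apply: gpred1. Qed.
Fact derived_pseries_invg n : invg_closed (derived_pseries n).
Proof. by case: n => //= n x; rewrite gpredV. Qed.

HB.instance Definition _ n :=
  isMulClosed.Build G (derived_pseries n) (@derived_pseries_mulg n).
HB.instance Definition _ n :=
  isMul1Closed.Build G (derived_pseries n) (@derived_pseries_1 n).
HB.instance Definition _ n :=
  isInvClosed.Build G (derived_pseries n) (@derived_pseries_invg n).

Fact derived_pseries_conj n (x y : G) :
  x \in derived_pseries n -> x ^ y \in derived_pseries n.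
Proof.
elim: n x y => //= n IHn x y; apply: gen_conj => {x y} z w [[x [y [xn yn ->]]]|].
  by left; exists (x ^ w), (y ^ w); rewrite conjRg !IHn.
by case=> x xn ->; right; exists (x ^ w); rewrite ?IHn// conjXg.
Qed.

HB.instance Definition _ n :=
  isConjClosed.Build G (derived_pseries n) (@derived_pseries_conj n).

Fact derived_pseries_group n : group_closed (derived_pseries n).
Proof. by split; [exact: gpred1 | exact: gpredF]. Qed.

Definition derived_subgroup n := {x : G | x \in derived_pseries n}.
HB.instance Definition _ n := SubChoice.on (derived_subgroup n).
HB.instance Definition _ n :=
  SubChoice_isSubGroup.Build G (derived_pseries n) (derived_subgroup n)
    (derived_pseries_group n).

Definition derived_incl n : {ghom derived_subgroup n -> G} := val.

End DerivedPSeries.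

Arguments derived_pseries p G n : clear implicits.
Arguments derived_subgroup p G n : clear implicits.
Arguments derived_incl p G n : clear implicits.

Lemma derived_pseries_morph p (G H : groupType) (f : {ghom G -> H}) n x :
  x \in derived_pseries p G n -> f x \in derived_pseries p H n.
Proof.
elim: n x => //= n IHn; apply: gen_morph => z [[x [y [xn yn ->]]]|[x xn ->]].
  by left; exists (f x), (f y); rewrite !IHn// gmulfR.
by right; exists (f x); rewrite ?IHn// gmulfXn.
Qed.

Definition derived_quot_map p (G H : groupType) (f : {ghom G -> H}) n
  : quot_group (derived_pseries p G n) -> quot_group (derived_pseries p H n) :=
  quot_map f.

Fact derived_quot_map_is_morphism p (G H : groupType) (f : {ghom G -> H}) n :
  {morph @derived_quot_map p G H f n : x y / x / y}.
Proof.
have fM : {morph @derived_quot_map p G H f n : x y / x * y}.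
  exact/quot_mapM/derived_pseries_morph.
by move=> x y; apply/eqP; rewrite eq_sym divg_eq -fM mulgVK.
Qed.
HB.instance Definition _ p (G H : groupType) (f : {ghom G -> H}) n :=
  isGroupMorphism.Build (quot_group (derived_pseries p G n))
    (quot_group (derived_pseries p H n)) (@derived_quot_map p G H f n)
    (@derived_quot_map_is_morphism p G H f n).

Module FreeGroup.
Section FreeGroup.
Variable X : choiceType.

(* A letter (x, false) stands for x and (x, true) for its inverse. *)
Definition word := seq (X * bool).

Definition inv_letter (a : X * bool) := (a.1, ~~ a.2).
Definition inv_word (w : word) : word := rev (map inv_letter w).

(* The equivalence relation generated by the free cancellations. *)
Inductive free_eq : word -> word -> Prop :=
| free_refl u : free_eq u u
| free_sym u v : free_eq u v -> free_eq v u
| free_trans v u w : free_eq u v -> free_eq v w -> free_eq u w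
| free_cancel a u v : free_eq (u ++ a :: inv_letter a :: v) (u ++ v).

Definition equiv (u v : word) : bool := `[< free_eq u v >].

Fact equiv_is_equiv : equiv_class_of equiv.
Proof.
split=> [u|u v|v u w]; first exact/asboolP/free_refl.
  by apply/asboolP/asboolP; apply: free_sym.
by move=> /asboolP uv /asboolP vw; apply/asboolP/(free_trans uv).
Qed.

Canonical equiv_equiv := EquivRelPack equiv_is_equiv.
Canonical equiv_encModRel := defaultEncModRel equiv.

Local Open Scope quotient_scope.
Definition free := {eq_quot equiv}.
#[export] HB.instance Definition _ := EqQuotient.on free.
#[export] HB.instance Definition _ := Choice.on free.

Lemma piP (u v : word) : \pi_free u = \pi_free v <-> free_eq u v.
Proof. by split=> [/eqquotP/asboolP|uv]; last exact/eqquotP/asboolP. Qed.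

Lemma repr_pi (u : word) : free_eq (repr (\pi_free u)) u.
Proof. by apply/piP; rewrite reprK. Qed.

Lemma free_eq_cat u u' v v' :
  free_eq u u' -> free_eq v v' -> free_eq (u ++ v) (u' ++ v').
Proof.
move=> uu' vv'; apply: (@free_trans (u' ++ v)).
  elim: uu' => [w|w w' _|w w' w'' _ ww' _|a w w']; try by constructor.
  - exact: free_trans.
  - by rewrite -!catA; constructor.
elim: vv' => [w|w w' _|w w' w'' _ ww' _|a w w']; try by constructor.
- exact: free_trans.
- by rewrite !catA; constructor.
Qed.

Lemma inv_letterK : involutive inv_letter.
Proof. by case=> x b; rewrite /inv_letter negbK. Qed.

Lemma inv_word_cat u v : inv_word (u ++ v) = inv_word v ++ inv_word u.
Proof. by rewrite /inv_word map_cat rev_cat. Qed.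

Lemma inv_wordK : involutive inv_word.
Proof. by move=> u; rewrite /inv_word map_rev revK mapK//; exact: inv_letterK. Qed.

Lemma free_eq_inv u v : free_eq u v -> free_eq (inv_word u) (inv_word v).
Proof.
elim=> [w|w w' _|w w' w'' _ ww' _|a w w']; try by constructor.
  exact: free_trans.
rewrite !inv_word_cat -[_ :: _]/([:: a; inv_letter a] ++ w') inv_word_cat.
rewrite -catA /inv_word /= inv_letterK; exact: free_cancel.
Qed.

Lemma free_eq_mulV w : free_eq (w ++ inv_word w) [::].
Proof.
elim: w => [|a w IHw]; first by constructor.
rewrite -cat1s inv_word_cat catA -(catA _ w).
apply: (@free_trans (([:: a] ++ [::]) ++ inv_word [:: a])).
  apply: free_eq_cat; last by constructor.
  by apply: free_eq_cat IHw; constructor.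
exact: (@free_cancel a [::] [::]).
Qed.

Definition mul := lift_op2 free (fun u v => u ++ v).
Definition one : free := lift_cst free [::].
Definition inv := lift_op1 free inv_word.

Lemma pi_mul (u v : word) : \pi_free (u ++ v) = mul (\pi_free u) (\pi_free v).
Proof.
unlock mul; apply/piP/free_sym.
exact: free_eq_cat (repr_pi u) (repr_pi v).
Qed.
Lemma pi_one : \pi_free [::] = one. Proof. by unlock one. Qed.
Lemma pi_inv (u : word) : \pi_free (inv_word u) = inv (\pi_free u).
Proof. unlock inv; exact/piP/free_sym/free_eq_inv/repr_pi. Qed.

Fact mulA : associative mul.
Proof.
by move=> x y z; rewrite -[x]reprK -[y]reprK -[z]reprK -!pi_mul catA.
Qed.
Fact mul1 : left_id one mul.
Proof. by move=> x; rewrite -[x]reprK -pi_one -pi_mul. Qed.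
Fact mulr1 : right_id one mul.
Proof. by move=> x; rewrite -[x]reprK -pi_one -pi_mul cats0. Qed.
Fact mulrV : right_inverse one inv mul.
Proof.
move=> x; rewrite -[x]reprK -pi_one -pi_inv -pi_mul.
exact/piP/free_eq_mulV.
Qed.
Fact mulV : left_inverse one inv mul.
Proof.
move=> x; rewrite -[x]reprK -pi_one -pi_inv -pi_mul.
by apply/piP; rewrite -[X in _ ++ X]inv_wordK; exact: free_eq_mulV.
Qed.

#[export] HB.instance Definition _ :=
  isGroup.Build free mulA mul1 mulr1 mulV mulrV.

Lemma piM (u v : word) : \pi_free (u ++ v) = \pi_free u * \pi_free v.
Proof. exact: pi_mul. Qed.

Definition gen_of (x : X) : free := \pi_free [:: (x, false)].

End FreeGroup.
Module Exports. HB.reexport. End Exports.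
End FreeGroup.
Export FreeGroup.Exports.

Notation free_group := FreeGroup.free.

Definition surjective (X Y : Type) (f : X -> Y) := forall y, exists x, f x = y.

Definition finitely_generated (G : groupType) :=
  exists s : seq G, forall x, x \in gen (fun y => y \in s).

Definition normal_closure (G : groupType) (R : seq G) : {pred G} :=
  gen (fun x => exists2 r, r \in R & exists y : G, x = r ^ y).

(* G is the quotient of a free group of finite rank by the normal closure *)
(* of finitely many relators.                                             *)
Definition finitely_presented (G : groupType) :=
  exists (n : nat) (f : {ghom free_group 'I_n -> G})
         (R : seq (free_group 'I_n)),
    surjective f /\ (forall w, f w = 1 <-> w \in normal_closure R).

(* Group homology with coefficients in 'F_p (trivial action), computed from *)
(* the inhomogeneous bar complex                                            *)

Local Open Scope ring_scope.

Section LinearExtension.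
Variables (R : comNzRingType) (K : choiceType) (V : lmodType R).

(* The linear extension to {malg R[K]}, the free module on K, of a map on K. *)
Definition lin_ext (h : K -> V) (c : {malg R[K]}) : V :=
  \sum_(k <- msupp c) c@_k *: h k.

Lemma lin_extEw h (D : {fset K}) c :
  (msupp c `<=` D)%fset -> lin_ext h c = \sum_(k <- D) c@_k *: h k.
Proof.
move=> cD; rewrite /lin_ext (big_fset_incl _ cD)// => k _ kc.
by rewrite mcoeff_outdom ?scale0r.
Qed.

Lemma lin_extU h k : lin_ext h << k >> = h k.
Proof. by rewrite /lin_ext msuppU oner_eq0 big_seq_fset1 mcoeffUU scale1r. Qed.

Fact lin_ext_is_linear h : linear (lin_ext h).
Proof.
move=> a c d; pose D := (msupp c `|` msupp d `|` msupp (a *: c + d))%fset.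
have cD : (msupp c `<=` D)%fset by rewrite /D -fsetUA fsubsetUl.
have dD : (msupp d `<=` D)%fset.
  by rewrite /D (fsetUC (msupp c)) -fsetUA fsubsetUl.
have sD : (msupp (a *: c + d) `<=` D)%fset by rewrite /D fsubsetUr.
rewrite (lin_extEw h cD) (lin_extEw h dD) (lin_extEw h sD).
rewrite scaler_sumr -big_split; apply: eq_bigr => k _ /=.
by rewrite mcoeffD mcoeffZ scalerDl scalerA.
Qed.
HB.instance Definition _ h :=
  GRing.isLinear.Build R {malg R[K]} V _ (lin_ext h) (lin_ext_is_linear h).

Lemma linear_lin_ext (L : {linear {malg R[K]} -> V}) c :
  L c = lin_ext (fun k => L << k >>) c.
Proof.
rewrite {1}[c]monalgE linear_sum; apply: eq_bigr => k _.
rewrite -linearZ; congr (L _); apply/malgP => k'.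
by rewrite mcoeffZ !mcoeffU mulrnAr mulr1.
Qed.
End LinearExtension.

Section BarComplex.
Variables (p : nat) (G : groupType).

Definition chain (n : nat) := {malg 'F_p[n.-tuple G]}.
HB.instance Definition _ n := GRing.Lmodule.on (chain n).

(* The i-th face of [g_1|...|g_n], 0 <= i <= n: drop g_1 when i = 0, drop   *)
(* g_n when i = n, and otherwise replace g_i, g_(i+1) by their product. The *)
(* sequence t is indexed from 0, so that t`_j is g_(j+1).                   *)
Definition bar_face n (i : nat) (t : n.-tuple G) : n.-1.-tuple G :=
  [tuple (if (j.+1 < i)%N then nth 1%g t j
          else if j.+1 == i then (nth 1%g t j * nth 1%g t j.+1)%g
          else nth 1%g t j.+1) | j < n.-1].

(* In degree 0 the boundary is zero. *)
Definition boundary n : chain n -> chain n.-1 :=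
  lin_ext (fun t =>
    if n == 0 then 0
    else \sum_(i < n.+1) (-1) ^+ i *: (<< bar_face i t >> : chain n.-1)).

HB.instance Definition _ n := GRing.Linear.on (@boundary n).

Lemma boundaryB n : {morph @boundary n : c d / c - d}.
Proof. exact: linearB. Qed.

Definition cycle_pred n : {pred chain n} := fun c => boundary c == 0.
Lemma in_cycle_pred n (c : chain n) : (c \in @cycle_pred n) = (boundary c == 0).
Proof. by []. Qed.
Fact cycle_zmod_closed n : zmod_closed (@cycle_pred n).
Proof.
split=> [|c d]; first by rewrite in_cycle_pred linear0.
by rewrite !in_cycle_pred boundaryB => /eqP -> /eqP ->; rewrite subr0.
Qed.
HB.instance Definition _ n :=
  GRing.isZmodClosed.Build (chain n) (@cycle_pred n) (@cycle_zmod_closed n).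

Definition cycles n := {c : chain n | c \in @cycle_pred n}.
HB.instance Definition _ n := SubChoice.on (cycles n).
HB.instance Definition _ n := [SubChoice_isSubZmodule of cycles n by <:].

Definition boundaries n : {pred cycles n} :=
  fun c => `[< exists b : chain n.+1, boundary b = val c >].
Fact boundaries_zmod_closed n : zmod_closed (@boundaries n).
Proof.
split=> [|c d]; first by apply/asboolP; exists 0; rewrite linear0.
move=> /asboolP[b bc] /asboolP[e ed]; apply/asboolP; exists (b - e).
by rewrite boundaryB bc ed.
Qed.
HB.instance Definition _ n :=
  GRing.isZmodClosed.Build (cycles n) (@boundaries n)
    (@boundaries_zmod_closed n).

Definition homology n := Quotient.quot (@boundaries n).
HB.instance Definition _ n := GRing.Zmodule.on (homology n).
HB.instance Definition _ n := EqQuotient.on (homology n).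

End BarComplex.

Arguments chain p G n : clear implicits.
Arguments cycles p G n : clear implicits.
Arguments homology p G n : clear implicits.
Arguments boundary {p G n} c.

Section InducedMap.
Variables (p : nat) (G H : groupType) (f : {ghom G -> H}).

Definition chain_map n : chain p G n -> chain p H n :=
  lin_ext (fun t => << map_tuple f t >>).
HB.instance Definition _ n := GRing.Linear.on (@chain_map n).

Lemma chain_mapB n : {morph @chain_map n : c d / c - d}.
Proof. exact: linearB. Qed.

Lemma bar_face_map n i (t : n.-tuple G) :
  map_tuple f (bar_face i t) = bar_face i (map_tuple f t).
Proof.
apply/eq_from_tnth => j; rewrite tnth_map !tnth_mktuple.
have jn : (j.+1 < n)%N by case: n {t} j => [|n] [].
by rewrite !(nth_map 1%g) ?size_tuple ?(ltnW jn)//;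
  do 2 case: ifP => _ //; rewrite gmulfM.
Qed.

Lemma boundary_chain_map n (c : chain p G n) :
  boundary (chain_map c) = chain_map (boundary c).
Proof.
pose L1 : {linear chain p G n -> chain p H n.-1} := boundary \o @chain_map n.
pose L2 : {linear chain p G n -> chain p H n.-1} := @chain_map n.-1 \o boundary.
suff: L1 c = L2 c by [].
rewrite (linear_lin_ext L1) (linear_lin_ext L2).
apply: eq_bigr => t _; congr (_ *: _).
rewrite /L1 /L2 /= /chain_map /boundary !lin_extU.
case: eqP => _; first by rewrite linear0.
rewrite linear_sum; apply: eq_bigr => i _.
by rewrite linearZ /= lin_extU bar_face_map.
Qed.

Fact cycle_map_proof n (c : cycles p G n) :
  chain_map (val c) \in @cycle_pred p H n.
Proof.
by rewrite in_cycle_pred boundary_chain_map (eqP (valP c)) /chain_map linear0.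
Qed.
Definition cycle_map n (c : cycles p G n) : cycles p H n :=
  Sub (chain_map (val c)) (cycle_map_proof c).

Local Open Scope quotient_scope.

(* The map f_* : H_n(G; Z/p) -> H_n(H; Z/p). *)
Definition homology_map n (x : homology p G n) : homology p H n :=
  \pi_(homology p H n) (cycle_map (repr x)).

Lemma homology_mapE n (c : cycles p G n) :
  homology_map (\pi_(homology p G n) c) = \pi_(homology p H n) (cycle_map c).
Proof.
have /asboolP[b bc] : repr (\pi_(homology p G n) c) - c \in @boundaries p G n.
  by rewrite Quotient.idealrBE reprK.
apply/eqP; rewrite -Quotient.idealrBE; apply/asboolP; exists (chain_map b).
by rewrite boundary_chain_map bc /= chain_mapB.
Qed.

Fact homology_map_is_zmod_morphism n : zmod_morphism (@homology_map n).
Proof.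
move=> x y; rewrite -[x]reprK -[y]reprK -raddfB !homology_mapE -raddfB.
congr (\pi _); apply/val_inj; exact: chain_mapB.
Qed.
HB.instance Definition _ n :=
  GRing.isZmodMorphism.Build (homology p G n) (homology p H n)
    (@homology_map n) (@homology_map_is_zmod_morphism n).

End InducedMap.

Arguments homology_map p {G H} f n x.
Arguments derived_quot_map p {G H} f n x.

Section Phi.
Variables (p : nat) (B : groupType) (m : nat).

(* The image of H_2(B^(m); Z/p) in H_2(B; Z/p). *)
Definition Phi : {pred homology p B 2} := fun y =>
  `[< exists x : homology p (derived_subgroup p B m) 2,
        homology_map p (derived_incl p B m) 2 x = y >].

Fact Phi_zmod_closed : zmod_closed Phi.
Proof.
split=> [|y z]; first by apply/asboolP; exists 0; rewrite raddf0.
by move=> /asboolP[u <-] /asboolP[v <-]; apply/asboolP; exists (u - v);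
  rewrite raddfB.
Qed.
HB.instance Definition _ :=
  GRing.isZmodClosed.Build (homology p B 2) Phi Phi_zmod_closed.

Definition H2_mod_Phi := Quotient.quot Phi.
HB.instance Definition _ := GRing.Zmodule.on H2_mod_Phi.
HB.instance Definition _ := EqQuotient.on H2_mod_Phi.

Definition H2_proj : homology p B 2 -> H2_mod_Phi := \pi_H2_mod_Phi%qT.
End Phi.

Arguments H2_proj {p B} m x.

(* Main.v *)
From HB Require Import structures.
From mathcomp Require Import all_fingroup all_solvable all_character.
Require Import Defs.
From mathcomp Require Import all_boot all_algebra.
From mathcomp Require Import boolp classical_sets finmap.
From mathcomp Require Import monalg.
From mathcomp Require Import ring.

Set Implicit Arguments.
Unset Strict Implicit.
Unset Printing Implicit Defensive.

Import GRing.Theory.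

Local Open Scope ring_scope.

(** The argument is cohomological. By linear duality over F_p, injectivity of
    H_1(A) -> H_1(B) says that every homomorphism A -> F_p extends along phi to
    B ([hom_extends_of_H1_injective]), and the hypothesis on H_2 says that a
    class of H^2(B; F_p) vanishing on A and on B^(m) is zero: it is a functional
    on H_2(B) killing the image of H_2(A) and Phi^(m)(B), which together span
    H_2(B) ([cocycle_split_of_H2_surjective]).

    Injectivity of A/A^(n) -> B/B^(n) goes by induction on n. Let n <= m and
    suppose it known for n, so that A^(n) is the preimage of B^(n). The elements
    of A^(n+1) are those killed by all homomorphisms A^(n) -> F_p, so it is
    enough to extend each of these to B^(n): the extension kills B^(n+1). Put
    Gamma = B/B^(n), a finite p-group ([derived_quotient_pgroup]). By Shapiro's construction a homomorphism
    A^(n) -> F_p is read off from a crossed homomorphism of A into the regular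
    module F_p[Gamma], and one extends the latter to B
    ([additive_on_kernel_extends]).

    The heart is [crossed_hom_extends]: crossed homomorphisms A -> M extend to B
    for every finite-dimensional F_p-module M of Gamma. A p-group fixes a nonzero
    vector v of M, and by induction on the dimension the crossed homomorphism
    extends modulo v, by a map b : B -> M. The failure of b to be a crossed
    homomorphism is a 2-cocycle with values in the line of v. It is a coboundary
    on A, where b agrees modulo v with a crossed homomorphism, and on B^(n),
    which acts trivially on M and contains B^(m); so it is a coboundary on B and
    b can be corrected. What then separates b from the given map on A is a
    homomorphism A -> F_p, which extends to B.

    For surjectivity, if phi(A) did not cover the finite p-group B/B^(n), its
    image would lie in a maximal subgroup, which contains commutators and p-th
    powers; this gives a nonzero homomorphism B -> F_p vanishing on phi(A),
    against the surjectivity of H_1(A) -> H_1(B) ([derived_surjective]). *)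

(** * Homomorphisms to F_p separating a point from a subgroup *)

(** A subgroup W maximal among those containing K and avoiding x exists by
    Zorn's lemma. Every y outside W generates x modulo W, and as y has order p
    modulo W, it is itself a power of x modulo W. So G/W is cyclic of order p,
    generated by x, and the exponent of x is the required homomorphism. *)
Lemma additive_separates p (G : groupType) (K : G -> Prop) (x : G) :
  prime p -> K 1%g -> (forall y z, K y -> K z -> K (y * z^-1)%g) ->
  (forall y z, K [~ y, z]%g) -> (forall y, K (y ^+ p)%g) -> ~ K x ->
  exists l : G -> 'F_p, [/\ {morph l : y z / (y * z)%g >-> y + z},
    forall y, K y -> l y = 0 & l x = 1].
Proof.
move=> p_pr K1 KF KR Kp Kx.
(* Nonemptiness is left out of P so that the empty chain has a bound; it is *)
(* recovered for W by comparison with K.                                    *)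
pose P (X : set G) := [/\ forall y z, X y -> X z -> X (y * z^-1)%g,
  forall y z, X y -> K z -> X (y * z)%g & ~ X x].
have [F FP Ftot|W [[WF WK Wx] Wmax]] := @Zorn_bigcup G P.
  split=> [y z [X FX Xy] [Y FY Yz]|y z [X FX Xy] Kz|[X FX]].
  - have [XY|YX] := Ftot _ _ FX FY.
      by exists Y => //; case: (FP _ FY) => YF _ _; apply: YF => //; apply: XY.
    by exists X => //; case: (FP _ FX) => XF _ _; apply: XF => //; apply: YX.
  - by exists X => //; case: (FP _ FX) => _ XK _; apply: XK.
  - by case: (FP _ FX).
have W1 : W 1%g.
  apply: contrapT => W1; have W0 y : ~ W y.
    by move=> Wy; apply: W1; rewrite -(mulgV y); apply: WF.
  apply: (Wmax K); last split=> // y z Ky Kz.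
    by split=> [y /W0//|KW]; apply/W0/KW/K1.
  by rewrite -[z]invgK -[z^-1%g]mul1g; apply: (KF) => //; apply: KF.
have KW y : K y -> W y by move=> Ky; rewrite -[y]mul1g; apply: WK.
have WV y : W y -> W y^-1%g by move=> Wy; rewrite -[y^-1%g]mul1g; apply: WF.
have WM y z : W y -> W z -> W (y * z)%g.
  by move=> Wy Wz; rewrite -[z]invgK; apply: WF => //; apply: WV.
have WC y z : W (y * z)%g -> W (z * y)%g.
  by move=> Wyz; rewrite commgC; apply: WM => //; apply: KW.
have WX y n : W y -> W (y ^+ n)%g.
  by move=> Wy; elim: n => [|n IHn] //; rewrite expgS; apply: WM.
pose E y z := W (y * z^-1)%g.
have Exx y : E y y by rewrite /E mulgV.
have Esym y z : E y z -> E z y by move=> /WV; rewrite /E invgM invgK.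
have Etrans y z t : E y z -> E z t -> E y t.
  by move=> yz zt; rewrite /E -(mulgVK z y) -mulgA; apply: WM.
have EM y z y' z' : E y z -> E y' z' -> E (y * y')%g (z * z')%g.
  move=> yz yz'; rewrite /E invgM mulgA; apply: (WC z^-1%g).
  rewrite -(mulgA y) (mulgA z^-1%g).
  by apply: WM => //; apply: WC.
have EX y z n : E y z -> E (y ^+ n)%g (z ^+ n)%g.
  by move=> yz; elim: n => [|n IHn]; rewrite ?expg0// !expgS; apply: (EM).
have EW y : W y -> E y 1%g by rewrite /E invg1 mulg1.
have Ep y n : E (y ^+ (n * p))%g 1%g by rewrite expgnA; apply/EW/KW/Kp.
(* Bezout: a power of y with exponent prime to p generates y modulo W. *)
have W_dvd y k : ~~ (p %| k)%N -> exists n, E ((y ^+ k) ^+ n)%g y.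
  move=> pk; have k_gt0 : (0 < k)%N by case: k pk => //; rewrite dvdn0.
  have [u v uv _] := egcdnP p k_gt0; exists u.
  have kp : gcdn k p = 1%N.
    by apply/eqP; rewrite -/(coprime k p) coprime_sym prime_coprime.
  rewrite -expgnA mulnC uv kp.
  by rewrite expgnDr -[y in E _ y]mul1g; apply: (EM); rewrite ?Ep// expg1.
have Wx_dvd k : W (x ^+ k)%g -> (p %| k)%N.
  move=> Wk; apply: contraT => /(W_dvd x)[n xkn]; case: Wx.
  by rewrite -[x]mulg1 -invg1; apply: (Etrans _ _ _ (Esym _ _ xkn)); apply/EW/WX.
have Ex_eq c d : E (x ^+ c)%g (x ^+ d)%g -> c%:R = d%:R :> 'F_p.
  wlog dc : c d / (d <= c)%N.
    by move=> th; case: (leqP d c) => [/th//|/ltnW/th{}th /Esym/th].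
  rewrite /E -expgnFr// => /Wx_dvd; rewrite (dvdn_pcharf (pchar_Fp p_pr)).
  by rewrite natrB// subr_eq0 => /eqP.
have Ex y : exists c, E y (x ^+ c)%g.
  have [Wy|Wy] := pselect (W y); first by exists 0%N; apply: EW.
  pose X : set G := fun z => exists k, E z (y ^+ k)%g.
  have [k xk] : X x.
    apply: contrapT => Xx; apply: (Wmax X).
      split=> [z Wz|XW]; first by exists 0%N; apply: EW.
      by apply/Wy/XW; exists 1%N.
    split=> // [z z' [k zk] [k' zk']|z z' [k zk] /KW Wz']; last first.
      by exists k; rewrite -[(y ^+ k)%g]mulg1; apply: (EM) => //; apply: EW.
    (* the inverse of y^k' is y^(k' (p - 1)) modulo W *)
    exists (k + k' * p.-1)%N; rewrite expgnDr; apply: (EM) => //.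
    have kk : (k' + k' * p.-1)%N = (k' * p)%N.
      by rewrite -mulnS prednK ?prime_gt0.
    rewrite -(mulKg z' (y ^+ _)%g) -{1}[z'^-1%g]mulg1.
    apply: (EM) => //.
    apply: Etrans (Esym _ _ (Ep y k')) _; rewrite -kk expgnDr; apply: (EM) => //.
    exact: Esym.
  have /(W_dvd y)[n yn] : ~~ (p %| k)%N.
    apply/negP => /dvdnP[j kE]; apply: Wx.
    by rewrite -[x]mulg1 -invg1; apply: Etrans xk _; rewrite kE.
  exists n; apply: Etrans (Esym _ _ yn) _; apply: (Esym); exact: EX.
have /boolp.choice[c cP] := Ex.
exists (fun y => (c y)%:R); split=> [y z|y Ky|].
- rewrite -natrD; apply: Ex_eq; rewrite expgnDr.
  by apply: Etrans (Esym _ _ (cP _)) _; apply: (EM).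
- apply: (Ex_eq _ 0%N); apply: Etrans (Esym _ _ (cP _)) _; exact/EW/KW.
- by apply: (Ex_eq _ 1%N); apply: Etrans (Esym _ _ (cP _)) _; rewrite expg1.
Qed.

(** * Quotients of finitely generated groups by the derived p-series *)

Section FiniteQuotients.
Local Open Scope group_scope.

(** Induction over a generated subgroup, for predicates that come without a
    subgroup structure. *)
Section GenInd.
Variables (G : groupType) (P : G -> Prop).
Hypotheses (P1 : P 1) (PM : forall x y, P x -> P y -> P (x * y))
  (PV : forall x, P x -> P x^-1).
Let H : {pred G} := fun x => `[< P x >].
Let HM : mulg_closed H.
Proof. by move=> x y /asboolP Px /asboolP Py; apply/asboolP/PM. Qed.
Let H1 : 1 \in H. Proof. exact/asboolP. Qed.
Let HV : invg_closed H.
Proof. by move=> x /asboolP Px; apply/asboolP/PV. Qed.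
HB.instance Definition _ := isMulClosed.Build G H HM.
HB.instance Definition _ := isMul1Closed.Build G H H1.
HB.instance Definition _ := isInvClosed.Build G H HV.

Lemma gen_ind (S : G -> Prop) :
  (forall y, S y -> P y) -> forall x, x \in gen S -> P x.
Proof.
by move=> SP x /genP/(_ H) xS; apply/asboolP/xS => y Sy; apply/asboolP/SP.
Qed.
End GenInd.

Lemma gen_sub (G : groupType) (H : groupClosed G) (S : G -> Prop) :
  (forall x, S x -> x \in H) -> forall x, x \in gen S -> x \in H.
Proof. by move=> SH x /genP; apply. Qed.

Lemma finite_gen_abelian p (Q : groupType) (s : seq Q) : (0 < p)%N ->
  {in s &, forall x y, commute x y} -> {in s, forall x, x ^+ p = 1} ->
  exists t : seq Q, forall x, x \in gen (fun y => y \in s) -> x \in t.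
Proof.
move=> p_gt0; elim: s => [|a s IHs] sC sX.
  exists [:: 1]; apply: gen_ind => //= [|y z|y]; rewrite !inE ?eqxx//.
    by move=> /eqP-> /eqP->; rewrite mulg1.
  by move=> /eqP->; rewrite invg1.
have [x y xs ys|x xs|t tP] := IHs.
- by apply: sC; rewrite inE ?xs ?ys orbT.
- by apply: sX; rewrite inE xs orbT.
have a1 : a ^+ p = 1 by apply: sX; rewrite inE eqxx.
have aC y : y \in gen (fun y => y \in s) -> commute a y.
  move: y; apply: gen_ind => [|x z|x|x xs].
  - exact: commute1.
  - exact: commuteM.
  - exact: commuteV.
  by apply: sC; rewrite ?inE ?eqxx ?xs ?orbT.
exists [seq a ^+ c * y | c <- iota 0 p, y <- t] => x xs.
suff [c [y [yt ->]]] : exists c y, y \in gen (fun y => y \in s) /\ x = a ^+ c * y.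
  rewrite (divn_eq c p) expgnDr mulnC expgnA a1 expg1n mul1g.
  by apply: allpairs_f; [rewrite mem_iota ltn_mod|exact: tP].
move: x xs; apply: gen_ind =>
  [|_ _ [c [y [yt ->]]] [d [z [zt ->]]]|_ [c [y [yt ->]]]|x].
- by exists 0%N, 1; rewrite gpred1 mulg1.
- exists (c + d)%N, (y * z); split; first by rewrite gpredM.
  rewrite expgnDr -!mulgA; congr (_ * _); rewrite !mulgA; congr (_ * _).
  exact: commuteX (commute_sym (aC y yt)).
- exists (c * p.-1)%N, y^-1; rewrite gpredV; split=> //.
  have ac : (a ^+ c)^-1 = a ^+ (c * p.-1).
    apply: (mulgI (a ^+ c)); rewrite mulgV -expgnDr -mulnS prednK//.
    by rewrite mulnC expgnA a1 expg1n.
  rewrite invgM ac; apply: commuteX; apply/commute_sym/aC.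
  by rewrite gpredV.
- rewrite inE => /orP[/eqP->|xs]; first by exists 1%N, 1; rewrite gpred1 mulg1.
  by exists 0%N, x; rewrite mul1g; split=> //; apply: mem_gen.
Qed.

Section QuotientProjection.
Variables (G : groupType) (N : normalClosed G).
Definition quot_proj (x : G) : quot_group N := (\pi_(quot_group N) x)%qT.
HB.instance Definition _ := isUMagmaMorphism.Build G (quot_group N) quot_proj
  (QuotientGroup.pi_one N, QuotientGroup.piM N).

Lemma quot_proj_eq1 x : (quot_proj x == 1) = (x \in N).
Proof.
rewrite eq_sym -(gmulf1 (s:=quot_proj)).
by rewrite (sameP eqP (QuotientGroup.eqP N 1 x)) invg1 mul1g.
Qed.

Lemma quot_projK : cancel repr quot_proj.
Proof. exact: reprK. Qed.
End QuotientProjection.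
Arguments quot_proj {G} N x.

Section Schreier.
Variables (G : groupType) (N : normalClosed G).
Let pi : {ghom G -> quot_group N} := quot_proj N.

(** Schreier's lemma. With r y the representative of the class of y, the
    elements y such that (r y)^-1 y lies in the subgroup H generated by the
    Schreier generators are stable under left multiplication by generators of
    G, hence are all of G; for y in N this says that y lies in r 1 H. *)
Lemma fg_of_finite_quotient (q : seq (quot_group N)) :
  (forall x, x \in q) -> finitely_generated G ->
  exists s : seq G, forall x, (x \in N) = (x \in gen (fun y => y \in s)).
Proof.
move=> qT [S GS].
pose r x := repr (pi x); have piR x : pi (r x) = pi x by exact: quot_projK.
pose S' := S ++ [seq x^-1 | x <- S].
(* r 1 lies in N but need not be 1, so it is added to the generators *)
pose s := r 1 :: [seq (r (x * repr t))^-1 * (x * repr t) | x <- S', t <- q].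
exists s => x; pose H := gen (fun y => y \in s).
have rN y z : pi y = pi z -> (r z)^-1 * y \in N.
  by move=> yz; rewrite -quot_proj_eq1 gmulfM gmulfV yz piR mulVg.
have HN y : y \in H -> y \in N.
  move: y; apply: gen_sub => y.
  rewrite inE => /orP[/eqP->|/allpairsP[[z t] [_ _ ->]]].
    by rewrite -[r 1]mulg1 -gpredV invgM invg1 mul1g -[_^-1]mulg1 rN.
  exact: rN.
have sH y : y \in s -> y \in H by exact: (@mem_gen _ (fun y => y \in s)).
pose X y := (r y)^-1 * y \in H.
have X1 : X 1 by rewrite /X mulg1 gpredV sH// inE eqxx.
have XS' y z : y \in S' -> X z -> X (y * z).
  move=> yS Xz; have rE : r (y * z) = r (y * r z) by rewrite /r !gmulfM piR.
  have -> : X (y * z) = ((r (y * r z))^-1 * (y * r z) * ((r z)^-1 * z) \in H).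
    by rewrite -!mulgA mulVKg -rE.
  rewrite gpredM//; apply: sH; rewrite inE; apply/orP; right.
  exact: (allpairs_f (fun x t => (r (x * repr t))^-1 * (x * repr t))).
have XG y : y \in gen (fun y => y \in S) ->
    forall z, (X z -> X (y * z)) /\ (X z -> X (y^-1 * z)).
  move: y; apply: gen_ind => [z|y1 y2 IH1 IH2 z|y IHy z|y yS z].
  - by rewrite invg1 mul1g.
  - rewrite invgM -!mulgA; split=> [/(proj1 (IH2 _))/(proj1 (IH1 _))//|].
    by move=> /(proj2 (IH1 _))/(proj2 (IH2 _)).
  - by rewrite invgK; split=> [/(proj2 (IHy _))//|/(proj1 (IHy _))].
  - by split; apply: XS'; rewrite mem_cat ?yS//; apply/orP; right; apply: map_f.
apply/idP/idP => [xN|/HN//].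
have := proj1 (XG x (GS x) 1) X1; rewrite mulg1 /X.
have -> : r x = r 1.
  by congr (repr _); rewrite [pi 1]gmulf1; apply/eqP; rewrite quot_proj_eq1.
by move=> xH; rewrite -[x](mulVKg (r 1)) gpredM// sH// inE eqxx.
Qed.
End Schreier.

(** By induction: when G / G^(n) is finite, G^(n) is finitely generated, so
    G^(n) / G^(n+1), being abelian of exponent p, is finite as well. *)
Lemma derived_quotient_finite p (G : groupType) n : (0 < p)%N ->
  finitely_generated G ->
  exists s : seq (quot_group (derived_pseries p G n)), forall q, q \in s.
Proof.
move=> p_gt0 fgG; elim: n => [|n [q qT]].
  exists [:: 1] => q; rewrite inE -[q]quot_projK.
  by rewrite (quot_proj_eq1 (derived_pseries p G 0)).
have [s sP] := fg_of_finite_quotient qT fgG.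
pose pi : {ghom G -> quot_group (derived_pseries p G n.+1)} := quot_proj _.
have sN x : x \in s -> x \in derived_pseries p G n.
  by move=> xs; rewrite sP; apply: mem_gen.
have [||t tP] := @finite_gen_abelian p _ [seq pi x | x <- s] p_gt0.
- move=> _ _ /mapP[x xs ->] /mapP[y ys ->]; apply/commgP.
  rewrite -gmulfR quot_proj_eq1 /=; apply: mem_gen; left.
  by exists x, y; split=> //; apply: sN.
- move=> _ /mapP[x xs ->]; rewrite -gmulfXn; apply/eqP.
  by rewrite quot_proj_eq1 /=; apply: mem_gen; right; exists x => //; apply: sN.
exists [seq pi (repr u) * v | u <- q, v <- t] => y; set g := repr y.
pose u := quot_proj (derived_pseries p G n) g.
have -> : y = pi (repr u) * pi ((repr u)^-1 * g).
  by rewrite -gmulfM mulVKg [RHS]quot_projK.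
apply: allpairs_f => //; apply: tP.
have : (repr u)^-1 * g \in derived_pseries p G n.
  by apply/QuotientGroup.eqP; exact: reprK.
rewrite sP; apply: gen_morph => x xs; exact: map_f.
Qed.

Section FiniteGroupOfList.
Variables (Q : groupType) (s : seq Q) (sT : forall x, x \in s).
(** The listing is kept as a parameter of the alias, so that the finite group
    structure can be inferred from the type alone. *)
Definition listed_group : Type := let _ := sT in Q.
HB.instance Definition _ := Group.on listed_group.
Let unpickle (i : nat) : listed_group := nth 1 s i.
Let pickleK : cancel (fun x : listed_group => index (x : Q) s) unpickle.
Proof. by move=> x; rewrite /unpickle nth_index. Qed.
HB.instance Definition _ : isCountable listed_group := CanIsCountable pickleK.
Let enumP : Finite.axiom (undup s : seq listed_group).
Proof. by move=> x; rewrite count_uniq_mem ?undup_uniq// mem_undup sT. Qed.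
HB.instance Definition _ := isFinite.Build listed_group enumP.
End FiniteGroupOfList.

Lemma expg_derived p (G : groupType) n (x : G) :
  x ^+ (p ^ n) \in derived_pseries p G n.
Proof.
elim: n => [|n IHn] //=; rewrite expnSr expgnA; apply: mem_gen; right.
by exists (x ^+ (p ^ n)).
Qed.

Lemma pgroup_expg p (gT : finGroupType) n : prime p ->
  (forall x : gT, x ^+ (p ^ n) = 1) -> p.-group [set: gT].
Proof.
move=> p_pr xp; apply/pgroupP => q q_pr /(Cauchy q_pr)[x _ xq].
have : (q %| p ^ n)%N by rewrite -xq order_dvdn xp.
by rewrite Euclid_dvdX// => /andP[+ _]; rewrite dvdn_prime2.
Qed.

Lemma derived_quotient_pgroup p (G : groupType) n : prime p ->
  finitely_generated G ->
  exists (gT : finGroupType) (pi : {ghom G -> gT}),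
    [/\ (p.-group [set: gT])%g, forall y, exists x, pi x = y
      & forall x, (pi x == 1%g) = (x \in derived_pseries p G n)].
Proof.
move=> p_pr fgG; have [s sT] := derived_quotient_finite n (prime_gt0 p_pr) fgG.
pose pi : {ghom G -> quot_group (derived_pseries p G n)} := quot_proj _.
exists (listed_group sT), (pi : {ghom G -> listed_group sT}).
have pi1 x : (pi x == 1%g) = (x \in derived_pseries p G n) by exact: quot_proj_eq1.
have pi_surj y : exists x, pi x = y by exists (repr y); exact: quot_projK.
split=> //; apply: (@pgroup_expg _ _ n) => // y.
by have [x <-] := pi_surj y; rewrite -gmulfXn; apply/eqP; rewrite pi1 expg_derived.
Qed.

End FiniteQuotients.

(** * Extending crossed homomorphisms *)

Definition cocycle2 p (G : groupType) (f : G -> G -> 'F_p) :=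
  forall x y z, f y z - f (x * y)%g z + f x (y * z)%g - f x y = 0.

Definition coboundary_on p (G : groupType) (S : {pred G}) (f : G -> G -> 'F_p) :=
  exists g : G -> 'F_p, {in S &, forall x y, f x y = g x + g y - g (x * y)%g}.

Definition additive_on p (G : groupType) (S : {pred G}) (l : G -> 'F_p) :=
  {in S &, {morph l : x y / (x * y)%g >-> x + y}}.

Lemma addr_cancel (V : zmodType) (a b c u w : V) :
  a + u + (b + w) - (c + (u + w)) = a + b - c.
Proof. by rewrite (addrACA a) opprD [LHS]addrACA subrr addr0. Qed.

(** The hypothesis cocycle_split says that a class of H^2(B; F_p) is zero as soon
    as it vanishes on A and on the kernel of pi. *)
Section CrossedHom.
Variables (p : nat) (A B : groupType) (phi : {ghom A -> B}).
Variables (gT : finGroupType) (pi : {ghom B -> gT}).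
Hypotheses (p_pr : prime p) (pgT : (p.-group [set: gT])%g).
Hypothesis hom_ext : forall l : A -> 'F_p, additive_on predT l ->
  exists2 k : B -> 'F_p, additive_on predT k & forall x, k (phi x) = l x.
Hypothesis cocycle_split : forall f : B -> B -> 'F_p, cocycle2 f ->
  coboundary_on predT (fun x y => f (phi x) (phi y)) ->
  coboundary_on [pred x | pi x == 1%g] f ->
  coboundary_on predT f.

(** Modules are right modules of row vectors, so the multiplier acts through the
    second factor. *)
Definition crossed_hom (G : groupType) (r : {ghom G -> gT}) n
    (rG : mx_representation 'F_p [set: gT] n) (a : G -> 'rV['F_p]_n) :=
  forall x y, a (x * y)%g = a x *m rG (r y) + a y.

(** The map b2 extends a modulo the line of a fixed vector v, b3 corrects it to a
    crossed homomorphism, and b4 corrects that to agree with a on A. *)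
Lemma crossed_hom_extends n (rG : mx_representation 'F_p [set: gT] n)
    (a : A -> 'rV['F_p]_n) :
  crossed_hom (pi \o phi) rG a ->
  exists2 b : B -> 'rV['F_p]_n, crossed_hom pi rG b & forall x, b (phi x) = a x.
Proof.
elim/ltn_ind: n => -[|n] IHn in rG a * => aM.
  by exists (fun=> 0) => [x y|x]; apply/rowP => -[].
have p_char : p \in [pchar 'F_p] by rewrite pchar_Fp.
have actM (w : 'rV_n.+1) x y :
    w *m rG (pi x) *m rG (pi y) = w *m rG (pi (x * y)%g).
  by rewrite gmulfM repr_mxM ?mulmxA.
have fix_n0 := rfix_pgroup_char p_char rG (ltn0Sn n) pgT.
have [v /rfix_mxP v_fix v_n0] := rowV0Pn (fix_n0 (subxx _)).
pose V := (<<v>>)%MS.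
have vmod : mxmodule rG V.
  by apply/mxmoduleP => x xG; rewrite (eqmxMr _ (genmxE v)) v_fix ?genmxE.
pose m := \rank (cokermx V).
have lt_m : (m < n.+1)%N.
  by rewrite /m mxrank_coker genmxE rank_rV v_n0 subn1.
pose a1 x := in_factmod V (a x).
have [b1 b1M b1a] : exists2 b : B -> 'rV['F_p]_m,
    crossed_hom pi (factmod_repr vmod) b & forall x, b (phi x) = a1 x.
  apply: IHn => // x y.
  by rewrite /a1 aM linearD /= in_factmodJ ?inE.
have [b2 b2P] : exists b2, forall x, in_factmod V (b2 x) = b1 x.
  by exists (fun x => val_factmod (b1 x)) => x; rewrite val_factmodK.
have sub_v (w : 'rV_n.+1) : in_factmod V w = 0 -> exists c : 'F_p, w = c *: v.
  by move/eqP; rewrite in_factmod_eq0 genmxE => /sub_rVP.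
have [j vj0] : exists j, v 0 j != 0.
  apply/existsP; apply: contraR v_n0; rewrite negb_exists => /forallP v0.
  apply/eqP/rowP => j; rewrite mxE; apply/eqP.
  by rewrite -[_ == _]negbK; apply: v0.
(* l is additive but not invariant: invariance is available on the line of v *)
(* and under the kernel of pi, which acts trivially.                         *)
have [l [lD lN lv]] : exists l : 'rV['F_p]_n.+1 -> 'F_p,
    [/\ {morph l : u w / u + w}, {morph l : u / - u}
      & forall c, l (c *: v) = c].
  exists (fun w => w 0 j / v 0 j); split=> [u w|u|c].
  - by rewrite !mxE mulrDl.
  - by rewrite !mxE mulNr.
  - by rewrite mxE mulfK.
(* the defect of b2, a cocycle with values in the line of v *)
have [d dE] : exists d : B -> B -> 'rV['F_p]_n.+1,
    forall x y, d x y = b2 x *m rG (pi y) + b2 y - b2 (x * y)%g.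
  by exists (fun x y => b2 x *m rG (pi y) + b2 y - b2 (x * y)%g).
have db2 x y : d x y = l (d x y) *: v.
  suff /sub_v[c ->] : in_factmod V (d x y) = 0 by rewrite lv.
  rewrite dE linearB linearD /= in_factmodJ ?inE// !b2P.
  by rewrite b1M subrr.
have vJ c x : c *: v *m rG (pi x) = c *: v by rewrite -scalemxAl v_fix ?inE.
have b2a x : b2 (phi x) - a x = l (b2 (phi x) - a x) *: v.
  suff /sub_v[c ->] : in_factmod V (b2 (phi x) - a x) = 0 by rewrite lv.
  by rewrite linearB /= b2P b1a subrr.
have [|||h hE] := cocycle_split (f := fun x y => l (d x y)).
- move=> x y z.
  have -> : l (d x y) = l (d x y *m rG (pi z)) by rewrite [in RHS]db2 vJ lv.
  rewrite !dE !mulmxDl !mulNmx !actM !(lD, lN) !mulgA.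
  by ring.
- exists (fun x => l (b2 (phi x) - a x)) => x y _ _.
  pose e x := l (b2 (phi x) - a x).
  have b2E z : b2 (phi z) = e z *: v + a z by rewrite -b2a subrK.
  suff -> : d (phi x) (phi y) = (e x + e y - e (x * y)%g) *: v by rewrite lv.
  rewrite dE -gmulfM !b2E aM mulmxDl vJ.
  by rewrite scalerBl scalerDl addr_cancel.
- exists (fun x => l (b2 x)) => x y /eqP x1 /eqP y1.
  by rewrite !dE y1 repr_mx1 mulmx1 !(lD, lN).
pose b3 x := b2 x - h x *: v.
have b3M : crossed_hom pi rG b3.
  move=> x y; have := db2 x y; rewrite hE// scalerBl scalerDl dE /b3 => e.
  have -> : b2 (x * y)%g = b2 x *m rG (pi y) + b2 y
      - (h x *: v + h y *: v - h (x * y)%g *: v) by rewrite -e subKr.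
  by rewrite mulmxBl vJ opprB addrA [LHS]addrAC addrK opprD [LHS]addrACA.
pose c x := l (a x - b3 (phi x)).
have ab3 x : a x = c x *: v + b3 (phi x).
  suff /sub_v[k akv] : in_factmod V (a x - b3 (phi x)) = 0.
    by rewrite /c akv lv -akv subrK.
  have -> : a x - b3 (phi x) = (h (phi x) - l (b2 (phi x) - a x)) *: v.
    by rewrite scalerBl -b2a opprB /b3 opprB addrCA.
  by apply/eqP; rewrite in_factmod_eq0 genmxE scalemx_sub.
have [|k kM kE] := hom_ext (l := c).
  move=> x y _ _; rewrite -(lv (c x + c y)) {1}/c; congr l.
  by rewrite aM gmulfM b3M !ab3 mulmxDl vJ addrACA addrK scalerDl.
have [b4 b4E] : exists b4, forall x, b4 x = b3 x + k x *: v by eexists.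
exists b4 => [x y|x]; rewrite !b4E; last first.
  by rewrite kE addrC -ab3.
by rewrite b3M kM// (mulmxDl (b3 x)) vJ scalerDl addrACA.
Qed.

Lemma regular_mxE (w : 'rV['F_p]_#|[set: gT]%g|) (y : gT) i :
  (w *m regular_repr 'F_p [set: gT] y) 0 i =
  w 0 (gring_index [set: gT] (enum_val i * y^-1)%g).
Proof.
set i0 := gring_index _ _; rewrite mxE (bigD1 i0) //= big1 => [|j ji].
  by rewrite !mxE /= gring_indexK ?inE// mulgVK gring_valK !eqxx mulr1 addr0.
rewrite !mxE /=; case: eqP => [iE|_]; last by rewrite mulr0.
by case/eqP: ji; rewrite /i0 iE gring_indexK ?inE// mulgK gring_valK.
Qed.

(** Shapiro's lemma for H^1. Choose L : A -> F_p with L (n z) = l n + L z for n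
    in the kernel of r = pi phi. Then a x : g |-> L z - L (z x^-1), where r z = g,
    does not depend on z, and a (extended by 0 outside the image of r) is a
    crossed homomorphism to the functions on the finite group whose value at 1
    restricts to l on the kernel. Evaluating at 1 an extension of a to B gives
    the extension of l. *)
Lemma additive_on_kernel_extends (l : A -> 'F_p) :
  additive_on [pred x | pi (phi x) == 1%g] l ->
  exists2 k : B -> 'F_p, additive_on [pred x | pi x == 1%g] k
    & forall x, pi (phi x) = 1%g -> k (phi x) = l x.
Proof.
move=> lM; pose r x := pi (phi x).
have rM : {morph r : x y / (x * y)%g} by move=> x y; rewrite /r !gmulfM.
have rV x : r x^-1%g = (r x)^-1%g by rewrite /r !gmulfV.
have /boolp.choice[s sP] : forall g : gT,
    exists z, (exists x, r x = g) -> r z = g.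
  move=> g; have [[x xg]|ng] := pselect (exists x, r x = g).
    by exists x.
  by exists 1%g.
have rs z : r (s (r z)) = r z by apply: sP; exists z.
pose L z := l (z * (s (r z))^-1)%g.
have LM n z : r n = 1%g -> L (n * z)%g = l n + L z.
  move=> n1; rewrite /L rM n1 mul1g -mulgA lM// inE -/(r _) ?n1//.
  by rewrite rM rV rs mulgV.
pose D x z := L z - L (z * x^-1)%g.
have DE x z z' : r z = r z' -> D x z = D x z'.
  move=> zz'; have n1 : r (z * z'^-1)%g = 1%g by rewrite rM rV zz' mulgV.
  rewrite -(mulgVK z' z) /D -(mulgA (z * z'^-1)%g) !(LM _ _ n1).
  by rewrite opprD [LHS]addrACA subrr add0r.
pose a x : 'rV['F_p]_#|[set: gT]%g| :=
  \row_i if `[< exists z, r z = enum_val i >] then D x (s (enum_val i)) else 0.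
have aE x z : a x 0 (gring_index [set: gT] (r z)) = D x z.
  rewrite mxE gring_indexK ?inE//; case: asboolP => [_|[]]; last by exists z.
  exact: DE.
have a0 x i : ~ (exists z, r z = enum_val i) -> a x 0 i = 0.
  by move=> nz; rewrite mxE; case: asboolP.
have [|b bM bE] :=
    crossed_hom_extends (rG := regular_repr 'F_p [set: gT]) (a := a).
  move=> x y; apply/rowP => i; rewrite [RHS]mxE regular_mxE /= -/(r y).
  have [[z zi]|nz] := pselect (exists z, r z = enum_val i).
    rewrite -zi -rV -rM aE -[i](gring_valK (G := [set: gT]%G)) -zi !aE.
    by rewrite /D invgM mulgA addrC addrA subrK.
  rewrite !a0 ?addr0//; apply: contra_not nz => -[z].
  by rewrite gring_indexK ?inE// => zi; exists (z * y)%g; rewrite rM zi mulgVK.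
exists (fun x => b x 0 (gring_index [set: gT] 1%g)) => [x y /eqP _ /eqP y1|x x1].
  by rewrite bM y1 repr_mx1 mulmx1 mxE.
have r1 : r 1%g = 1%g by rewrite /r !gmulf1.
rewrite bE -[X in gring_index _ X]r1 aE /D mul1g.
by have := LM x x^-1%g x1; rewrite mulgV => ->; rewrite addrK.
Qed.
End CrossedHom.

(** * Functionals on the bar complex *)

(** An alias, so that the separation of points from subgroups applies to additive
    groups. *)
Definition multiplicative (V : zmodType) : Type := V.
HB.instance Definition _ (V : zmodType) := Choice.on (multiplicative V).
HB.instance Definition _ (V : zmodType) := isGroup.Build (multiplicative V)
  (@addrA V) (@add0r V) (@addr0 V) (@addNr V) (@addrN V).

(** If F is not zero, say F u <> 0, then D u is not in the image under D of the
    kernel of F; a functional that separates the two is, up to the factor F u,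
    the required one. *)
Lemma functional_factors p (V W : lmodType 'F_p) (D : {linear V -> W})
    (F : {linear V -> ('F_p)^o}) :
  prime p -> (forall v, D v = 0 -> F v = 0) ->
  exists L : {linear W -> ('F_p)^o}, forall v, L (D v) = F v.
Proof.
move=> p_pr DF; have [F0|] := pselect (forall v, F v = 0).
  by exists (\0 : {linear W -> ('F_p)^o}) => v; rewrite F0.
move=> /existsNP[u /eqP Fu].
pose K (w : W) := exists2 v, F v = 0 & w = D v.
have [|||||l [lD lK lu]] := @additive_separates p (multiplicative W) K (D u) p_pr.
- by exists 0; rewrite raddf0.
- move=> _ _ [v Fv ->] [w Fw ->]; exists (v - w); last by rewrite raddfB.
  by rewrite linearB Fv Fw subr0.
- move=> y z; exists 0; rewrite raddf0//; apply/eqP/commgP; exact: addrC.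
- move=> y; exists 0; rewrite raddf0//.
  have expE n : (y ^+ n)%g = (y : W) *+ n :> W.
    by elim: n => [|n IHn]; rewrite ?expgS ?mulrS -?IHn.
  by rewrite expE -scaler_nat pchar_Fp_0// scale0r.
- move=> [v Fv Duv]; case/eqP: Fu; rewrite -[u](subrK v) linearD Fv addr0.
  by apply: DF; rewrite linearB Duv subrr.
have l0 : l 0 = 0 by apply: lK; exists 0; rewrite raddf0.
have lMn w n : l (w *+ n) = l w *+ n.
  by elim: n => [|n IHn]; rewrite ?mulr0n// !mulrS lD IHn.
(* additive maps of F_p-modules are F_p-linear *)
have L_lin : linear (fun w => F u * l w : ('F_p)^o).
  move=> c v w /=; rewrite [l _]lD mulrDr; congr (_ + _).
  by rewrite -[c]natr_Zp !scaler_nat lMn mulrnAr.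
have [L LE] : exists L : {linear W -> ('F_p)^o}, forall w, L w = F u * l w.
  by exists (HB.pack_for {linear W -> ('F_p)^o} (fun w => F u * l w : ('F_p)^o)
    (GRing.isLinear.Build _ _ _ _ _ L_lin)).
exists L => v; pose a := F v / F u.
have Fw : F (v - a *: u) = 0.
  by rewrite linearB linearZ /= [_ *: _]mulfVK ?subrr.
have : L (D (v - a *: u)) = 0 by rewrite LE lK ?mulr0//; exists (v - a *: u).
rewrite !linearB [D (a *: u)]linearZ [L (a *: _)]linearZ /= (LE (D u)) lu mulr1.
by rewrite [_ *: _]mulfVK// => /eqP; rewrite subr_eq0 => /eqP.
Qed.

Lemma boundaryU p (G : groupType) n (t : n.+1.-tuple G) :
  boundary (<< t >> : chain p G n.+1) =
  \sum_(i < n.+2) (-1) ^+ i *: (<< bar_face i t >> : chain p G n).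
Proof. by rewrite /boundary lin_extU. Qed.

Lemma alt_sum3 (R : nzRingType) (V : lmodType R) (u : nat -> V) :
  \sum_(i < 3) (-1) ^+ i *: u i = u 0%N - u 1%N + u 2%N.
Proof.
rewrite !big_ord_recr big_ord0 /= expr0 scale1r expr1 scaleN1r sqrrN expr1n.
by rewrite scale1r add0r.
Qed.

Lemma alt_sum4 (R : nzRingType) (V : lmodType R) (u : nat -> V) :
  \sum_(i < 4) (-1) ^+ i *: u i = u 0%N - u 1%N + u 2%N - u 3%N.
Proof.
by rewrite big_ord_recr alt_sum3 /= exprS sqrrN expr1n mulr1 scaleN1r.
Qed.

Lemma boundary_U2 p (G : groupType) (x y : G) :
  boundary (<< [tuple x; y] >> : chain p G 2) =
  << [tuple y] >> - << [tuple (x * y)%g] >> + << [tuple x] >>.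
Proof.
rewrite boundaryU.
apply: etrans (alt_sum3 (fun i => << bar_face i [tuple x; y] >> : chain p G 1)) _.
have f0 : bar_face 0 [tuple x; y] = [tuple y].
  by apply/eq_from_tnth => i; rewrite [i]ord1 tnth_mktuple.
have f1 : bar_face 1 [tuple x; y] = [tuple (x * y)%g].
  by apply/eq_from_tnth => i; rewrite [i]ord1 tnth_mktuple.
have f2 : bar_face 2 [tuple x; y] = [tuple x].
  by apply/eq_from_tnth => i; rewrite [i]ord1 tnth_mktuple.
by rewrite f0 f1 f2.
Qed.

Lemma boundary_U3 p (G : groupType) (x y z : G) :
  boundary (<< [tuple x; y; z] >> : chain p G 3) =
  << [tuple y; z] >> - << [tuple (x * y)%g; z] >>
  + << [tuple x; (y * z)%g] >> - << [tuple x; y] >>.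
Proof.
rewrite boundaryU.
apply: etrans
  (alt_sum4 (fun i => << bar_face i [tuple x; y; z] >> : chain p G 2)) _.
have f0 : bar_face 0 [tuple x; y; z] = [tuple y; z].
  by apply/eq_from_tnth; case=> -[|[|//]] ?; rewrite tnth_mktuple.
have f1 : bar_face 1 [tuple x; y; z] = [tuple (x * y)%g; z].
  by apply/eq_from_tnth; case=> -[|[|//]] ?; rewrite tnth_mktuple.
have f2 : bar_face 2 [tuple x; y; z] = [tuple x; (y * z)%g].
  by apply/eq_from_tnth; case=> -[|[|//]] ?; rewrite tnth_mktuple.
have f3 : bar_face 3 [tuple x; y; z] = [tuple x; y].
  by apply/eq_from_tnth; case=> -[|[|//]] ?; rewrite tnth_mktuple.
by rewrite f0 f1 f2 f3.
Qed.

Lemma linear_eq_basis (R : comNzRingType) (K : choiceType) (V : lmodType R)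
    (L M : {linear {malg R[K]} -> V}) :
  (forall k, L << k >> = M << k >>) -> forall c, L c = M c.
Proof.
move=> LM c; rewrite (linear_lin_ext L) (linear_lin_ext M).
by apply: eq_bigr => k _; rewrite LM.
Qed.

Lemma tuple1E (T : Type) (t : 1.-tuple T) : exists x, t = [tuple x].
Proof. by case: t => [[|x [|]]] // i; exists x; apply: val_inj. Qed.

Lemma tuple2E (T : Type) (t : 2.-tuple T) : exists x y, t = [tuple x; y].
Proof. by case: t => [[|x [|y [|]]]] // i; exists x, y; apply: val_inj. Qed.

Lemma tuple3E (T : Type) (t : 3.-tuple T) : exists x y z, t = [tuple x; y; z].
Proof.
by case: t => [[|x [|y [|z [|]]]]] // i; exists x, y, z; apply: val_inj.
Qed.

(** Functions on G and on pairs of elements of G as 1- and 2-cochains, that is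
    functionals on the chain groups. *)
Section Evaluation.
Variables (p : nat) (G : groupType).

Definition eval1 (l : G -> 'F_p) : chain p G 1 -> ('F_p)^o :=
  lin_ext (fun t : 1.-tuple G => l (nth 1%g t 0) : ('F_p)^o).
HB.instance Definition _ l := GRing.Linear.on (eval1 l).

Definition eval2 (f : G -> G -> 'F_p) : chain p G 2 -> ('F_p)^o :=
  lin_ext (fun t : 2.-tuple G => f (nth 1%g t 0) (nth 1%g t 1) : ('F_p)^o).
HB.instance Definition _ f := GRing.Linear.on (eval2 f).

Lemma eval1U l x : eval1 l << [tuple x] >> = l x.
Proof. by rewrite /eval1 lin_extU. Qed.

Lemma eval2U f x y : eval2 f << [tuple x; y] >> = f x y.
Proof. by rewrite /eval2 lin_extU. Qed.

Lemma eval1D l : {morph eval1 l : c d / c + d}. Proof. exact: linearD. Qed.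
Lemma eval1B l : {morph eval1 l : c d / c - d}. Proof. exact: linearB. Qed.
Lemma eval2D f : {morph eval2 f : c d / c + d}. Proof. exact: linearD. Qed.
Lemma eval2B f : {morph eval2 f : c d / c - d}. Proof. exact: linearB. Qed.

Lemma eval1_boundary l (c : chain p G 2) :
  eval1 l (boundary c) = eval2 (fun x y => l x + l y - l (x * y)%g) c.
Proof.
pose L : {linear chain p G 2 -> ('F_p)^o} := eval1 l \o @boundary p G 2.
pose M : {linear chain p G 2 -> ('F_p)^o} :=
  eval2 (fun x y => l x + l y - l (x * y)%g).
apply: (linear_eq_basis (L := L) (M := M)) => t.
have [x [y ->]] := tuple2E t.
suff: eval1 l (boundary (<< [tuple x; y] >> : chain p G 2))
    = l x + l y - l (x * y)%g by move=> e; apply: etrans e _; exact/esym/eval2U.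
rewrite boundary_U2 eval1D eval1B addrC addrA.
by congr (_ + _ - _); exact: eval1U.
Qed.

Lemma eval2_boundary f (c : chain p G 3) : cocycle2 f -> eval2 f (boundary c) = 0.
Proof.
move=> f_cocycle; pose L : {linear chain p G 3 -> ('F_p)^o} := eval2 f \o @boundary p G 3.
apply: (linear_eq_basis (L := L) (M := \0)) => t.
have [x [y [z ->]]] := tuple3E t.
suff: eval2 f (boundary (<< [tuple x; y; z] >> : chain p G 3)) = 0 by [].
rewrite -(f_cocycle x y z) boundary_U3 eval2B eval2D eval2B.
by congr (_ - _ + _ - _); exact: eval2U.
Qed.

Lemma eval2_ext f g c : f =2 g -> eval2 f c = eval2 g c.
Proof.
move=> fg; pose L : {linear chain p G 2 -> ('F_p)^o} := eval2 f.
pose M : {linear chain p G 2 -> ('F_p)^o} := eval2 g.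
apply: (linear_eq_basis (L := L) (M := M)) => t.
by have [x [y ->]] := tuple2E t; rewrite /L /M /= !eval2U.
Qed.

Lemma eval1_boundary_additive l (c : chain p G 2) :
  additive_on predT l -> eval1 l (boundary c) = 0.
Proof.
move=> lM; rewrite eval1_boundary (eval2_ext (g := fun _ _ => 0)) => [|x y].
  by rewrite /eval2 /lin_ext big1// => k _; rewrite scaler0.
by rewrite lM// subrr.
Qed.

Lemma boundary1 (c : chain p G 1) : boundary c = 0.
Proof.
pose L : {linear chain p G 1 -> chain p G 0} := @boundary p G 1.
apply: (linear_eq_basis (L := L) (M := \0)) => t.
rewrite /L /= boundaryU big_ord_recr big_ord1 /= expr0 scale1r expr1 scaleN1r.
have -> : bar_face 0 t = bar_face 1 t by apply/eq_from_tnth; case.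
exact: subrr.
Qed.
End Evaluation.

Section EvaluationMap.
Variables (p : nat) (G H : groupType) (f : {ghom G -> H}).

Lemma chain_mapU n (t : n.-tuple G) :
  chain_map f (<< t >> : chain p G n) = << map_tuple f t >>.
Proof. by rewrite /chain_map lin_extU. Qed.

Lemma eval1_map (l : H -> 'F_p) c : eval1 l (chain_map f c) = eval1 (l \o f) c.
Proof.
pose L : {linear chain p G 1 -> ('F_p)^o} := eval1 l \o @chain_map p _ _ f 1.
pose M : {linear chain p G 1 -> ('F_p)^o} := eval1 (l \o f).
apply: (linear_eq_basis (L := L) (M := M)) => t.
have [x ->] := tuple1E t; rewrite /L /M /= chain_mapU eval1U.
have -> : map_tuple f [tuple x] = [tuple f x] by exact: val_inj.
by rewrite eval1U.
Qed.

Lemma eval2_map (l : H -> H -> 'F_p) c :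
  eval2 l (chain_map f c) = eval2 (fun x y => l (f x) (f y)) c.
Proof.
pose L : {linear chain p G 2 -> ('F_p)^o} := eval2 l \o @chain_map p _ _ f 2.
pose M : {linear chain p G 2 -> ('F_p)^o} := eval2 (fun x y => l (f x) (f y)).
apply: (linear_eq_basis (L := L) (M := M)) => t.
have [x [y ->]] := tuple2E t; rewrite /L /M /= chain_mapU eval2U.
have -> : map_tuple f [tuple x; y] = [tuple f x; f y] by exact: val_inj.
by rewrite eval2U.
Qed.
End EvaluationMap.

Lemma homology_eqP p (G : groupType) n (c d : cycles p G n) :
  (\pi_(homology p G n) c = \pi_(homology p G n) d)%qT <->
  exists b : chain p G n.+1, boundary b = val c - val d.
Proof.
split=> [/eqP|[b bE]].
  by rewrite -Quotient.idealrBE => /asboolP.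
by apply/eqP; rewrite -Quotient.idealrBE; apply/asboolP; exists b.
Qed.

(** * Dual form of the hypotheses on homology *)

Fact cycle1_proof p (G : groupType) (c : chain p G 1) : c \in @cycle_pred p G 1.
Proof. by rewrite in_cycle_pred boundary1. Qed.

Definition cycle1 p (G : groupType) (c : chain p G 1) : cycles p G 1 :=
  Sub c (cycle1_proof c).

Section FirstHomology.
Variables (p : nat) (A B : groupType) (phi : {ghom A -> B}).

(** A homomorphism l, as a functional on 1-chains of A, vanishes on a whenever
    phi(a) + (boundary of e) = 0, because then a is a boundary by injectivity.
    So it factors through (a, e) |-> phi(a) + (boundary of e); the resulting
    functional on 1-chains of B kills boundaries, i.e. is a homomorphism. *)
Lemma hom_extends_of_H1_injective : prime p -> injective (homology_map p phi 1) ->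
  forall l : A -> 'F_p, additive_on predT l ->
  exists2 k : B -> 'F_p, additive_on predT k & forall x, k (phi x) = l x.
Proof.
move=> p_pr inj l lM.
pose D : {linear (chain p A 1 * chain p B 2)%type -> chain p B 1} :=
  (@chain_map p A B phi 1 \o fst) \+ (@boundary p B 2 \o snd).
pose F : {linear (chain p A 1 * chain p B 2)%type -> ('F_p)^o} := eval1 l \o fst.
have [|L LD] := @functional_factors p _ _ D F p_pr.
  move=> [a e]; rewrite /D /F /= => ae0.
  have /homology_eqP[b /= bE] :
      (\pi_(homology p A 1) (cycle1 a) = \pi_(homology p A 1) 0)%qT.
    apply: inj; rewrite !homology_mapE; apply/homology_eqP; exists (- e) => /=.
    by rewrite !linearN linear0 /= subr0 -[RHS](addrK (boundary e)) ae0 sub0r.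
  by have := eval1_boundary_additive b lM; rewrite bE subr0.
pose k y : 'F_p := L << [tuple y] >>.
have Lk c : L c = eval1 k c.
  pose M : {linear chain p B 1 -> ('F_p)^o} := eval1 k.
  apply: (linear_eq_basis (L := L) (M := M)) => t.
  by have [x ->] := tuple1E t; apply/esym/eval1U.
exists k => [x y _ _|x].
  have := LD (0, << [tuple x; y] >>); rewrite /D /F /= !linear0 add0r Lk.
  rewrite eval1_boundary eval2U => /eqP; rewrite subr_eq0 => /eqP.
  by [].
have := LD (<< [tuple x] >>, 0); rewrite /D /F /= linear0 addr0 Lk.
by rewrite eval1_map !eval1U.
Qed.

(** Each 1-chain of B is homologous to the image of a 1-chain of A, where k
    vanishes. *)
Lemma hom_eq0_of_H1_surjective (k : B -> 'F_p) :
  surjective (homology_map p phi 1) -> additive_on predT k ->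
  (forall x, k (phi x) = 0) -> forall y, k y = 0.
Proof.
move=> surj kM kphi y.
have [a aE] := surj (\pi_(homology p B 1) (cycle1 << [tuple y] >>))%qT.
have /esym/homology_eqP[b /= bE] := aE.
have := eval1_boundary_additive b kM; rewrite bE eval1B eval1U eval1_map.
move/eqP; rewrite subr_eq0 => /eqP ->.
by rewrite /eval1 /lin_ext big1// => t _; rewrite /= kphi scaler0.
Qed.
End FirstHomology.

Lemma eval2_coboundary_cycle p (G : groupType) (f : G -> G -> 'F_p)
    (c : cycles p G 2) :
  coboundary_on predT f -> eval2 f (val c) = 0.
Proof.
move=> [g fE]; rewrite (eval2_ext (g := fun x y => g x + g y - g (x * y)%g)).
  rewrite -eval1_boundary; have /eqP -> := valP c; exact: linear0.
by move=> x y; rewrite fE.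
Qed.

(** Modulo boundaries every 2-cycle of B is the sum of a cycle from A and a cycle
    from B^(m), on both of which f vanishes. So the functional f on 2-chains
    vanishes on cycles and factors through the boundary map; the factor is a
    1-cochain whose coboundary is f. *)
Lemma cocycle_split_of_H2_surjective p m (A B : groupType) (phi : {ghom A -> B}) :
  prime p ->
  surjective (fun x : homology p A 2 => H2_proj m (homology_map p phi 2 x)) ->
  forall f : B -> B -> 'F_p, cocycle2 f ->
  coboundary_on predT (fun x y => f (phi x) (phi y)) ->
  coboundary_on (derived_pseries p B m) f ->
  coboundary_on predT f.
Proof.
move=> p_pr surj f f_cocycle fA fN.
have fC (c : cycles p B 2) : eval2 f (val c) = 0.
  have [a] := surj (H2_proj m (\pi_(homology p B 2) c)%qT).
  move=> /esym/eqP; rewrite -Quotient.idealrBE => /asboolP[w].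
  rewrite -[a]reprK -[w]reprK !homology_mapE -raddfB /=.
  move=> /esym/homology_eqP[b /= bE].
  have := eval2_boundary b f_cocycle; rewrite bE !eval2B !eval2_map.
  rewrite (eval2_coboundary_cycle (repr a) fA).
  rewrite (eval2_coboundary_cycle (f := fun x y => f (val x) (val y)) (repr w)).
    by rewrite !subr0.
  have [g gE] := fN; exists (g \o val) => x y _ _ /=.
  exact: (gE _ _ (valP x) (valP y)).
have [v /eqP|L LE] :=
    @functional_factors p _ _ (@boundary p B 2) (eval2 f) p_pr.
  by rewrite -in_cycle_pred => vC; have := fC (Sub v vC); rewrite SubK.
exists (fun x => L << [tuple x] >>) => x y _ _.
have : L (boundary (<< [tuple x; y] >> : chain p B 2)) = f x y.
  by rewrite -(eval2U f); exact: LE.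
by rewrite boundary_U2 => <-; rewrite linearD linearB addrC addrA.
Qed.

(** * The derived p-series and the theorem *)

Lemma finitely_presented_generated (G : groupType) :
  finitely_presented G -> finitely_generated G.
Proof.
move=> [n [f [R [f_surj _]]]]; exists [seq f (FreeGroup.gen_of i) | i <- enum 'I_n].
move=> y; have [w <-] := f_surj y; rewrite -[w]reprK.
elim: (repr w) => [|[i b] u IHu]; first by rewrite FreeGroup.pi_one gmulf1 gpred1.
rewrite -cat1s FreeGroup.piM gmulfM gpredM//.
have fi : f (FreeGroup.gen_of i) \in
    gen (fun y => y \in [seq f (FreeGroup.gen_of i) | i <- enum 'I_n]).
  by apply: mem_gen; apply: map_f; rewrite mem_enum.
case: b => //.
rewrite -[[:: (i, true)]]/(FreeGroup.inv_word [:: (i, false)]) FreeGroup.pi_inv.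
by rewrite gmulfV gpredV.
Qed.

Section DerivedSeriesHoms.
Variable p : nat.
Hypothesis p_pr : prime p.

Lemma derived_pseries_le (G : groupType) n k : (n <= k)%N ->
  {subset derived_pseries p G k <= derived_pseries p G n}.
Proof.
elim: k => [|k IHk]; first by rewrite leqn0 => /eqP->.
rewrite leq_eqVlt ltnS => /orP[/eqP->//|/IHk sub] x xk; apply: sub.
move: x xk; apply: gen_sub => x [[y [z [yk zk ->]]]|[y yk ->]].
  exact: gpredR.
exact: gpredXn.
Qed.

Lemma additive_on_derived_eq0 (G : groupType) n (k : G -> 'F_p) :
  additive_on (derived_pseries p G n) k ->
  forall x, x \in derived_pseries p G n.+1 -> k x = 0.
Proof.
move=> kM; have k1 : k 1%g = 0.
  by apply: (addrI (k 1%g)); rewrite -kM ?gpred1// mulg1 addr0.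
have kV x : x \in derived_pseries p G n -> k x^-1%g = - k x.
  by move=> xn; apply: (addrI (k x)); rewrite -kM ?gpredV// mulgV subrr.
have kX x j : x \in derived_pseries p G n -> k (x ^+ j)%g = k x *+ j.
  move=> xn; elim: j => [|j IHj]; first by rewrite expg0.
  by rewrite expgS kM ?gpredXn// IHj mulrS.
move=> x xn1.
suff [] : x \in derived_pseries p G n /\ k x = 0 by [].
move: x xn1; apply: gen_ind => [|x y [xn x0] [yn y0]|x [xn x0]|x].
- by rewrite gpred1.
- by rewrite gpredM ?kM// x0 y0 addr0.
- by rewrite gpredV xn kV// x0 oppr0.
- case=> [[y [z [yn zn ->]]]|[y yn ->]].
    split; first exact: gpredR.
    rewrite commgEl conjgE !kM ?gpredM ?gpredV// !kV//.
    by rewrite [k y + _]addrC addKr addNr.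
  by rewrite gpredXn// kX// -mulr_natr pchar_Fp_0// mulr0.
Qed.

(** G^(n) / G^(n+1) is an F_p-vector space, whose nonzero vectors are detected by
    functionals. *)
Lemma derived_separates (G : groupType) n x :
  x \in derived_pseries p G n -> x \notin derived_pseries p G n.+1 ->
  exists l : G -> 'F_p, [/\ additive_on (derived_pseries p G n) l & l x = 1].
Proof.
move=> xn xn1; pose K (u : derived_subgroup p G n) := val u \in derived_pseries p G n.+1.
have [|||||l [lM _ lx]] := @additive_separates p (derived_subgroup p G n) K (Sub x xn) p_pr.
- exact: gpred1.
- move=> y z yK zK.
  have : (val y * (val z)^-1)%g \in derived_pseries p G n.+1 by rewrite gpredM ?gpredV.
  by [].
- move=> y z; rewrite /K /=; apply: mem_gen; left.
  exists (val y), (val z); split; [exact: (valP y)|exact: (valP z)|].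
  exact: (gmulfR (derived_incl p G n) y z).
- move=> y; rewrite /K /=; apply: mem_gen; right.
  exists (val y); first exact: (valP y).
  exact: (gmulfXn (derived_incl p G n) p y).
- by rewrite /K SubK; apply/negP.
exists (fun y => l (insubd (Sub x xn) y)); split; last first.
  by rewrite /insubd insubT.
move=> y z yn zn; rewrite -lM; congr l; apply: val_inj.
have vM (u v : derived_subgroup p G n) : val (u * v)%g = (val u * val v)%g by [].
by rewrite vM !insubdK// -topredE /= gpredM.
Qed.

End DerivedSeriesHoms.

Section DerivedSeriesMap.
Variables (p m : nat) (A B : groupType) (phi : {ghom A -> B}).
Hypotheses (p_pr : prime p) (fgB : finitely_generated B).

(** If phi x is in B^(n+1) but x is not in A^(n+1), a homomorphism A^(n) -> F_p
    with value 1 at x extends to B^(n), where it must vanish at phi x. *)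
Lemma derived_preimage :
  surjective (fun x : homology p A 2 => H2_proj m (homology_map p phi 2 x)) ->
  injective (homology_map p phi 1) -> forall n, (n <= m.+1)%N ->
  forall x, phi x \in derived_pseries p B n -> x \in derived_pseries p A n.
Proof.
move=> H2_surj H1_inj; elim=> [//|n IHn] n_m x phi_x.
have le_nm : (n <= m)%N by [].
have IH y : phi y \in derived_pseries p B n -> y \in derived_pseries p A n.
  exact/IHn/ltnW.
apply: contraT => xA.
have phi_xn := derived_pseries_le (leqnSn n) phi_x.
have [l [lM lx]] := derived_separates p_pr (IH _ phi_xn) xA.
have [gT [pi [gTp pi_surj pi1]]] := derived_quotient_pgroup n p_pr fgB.
have [f f_cocycle fA [g fN]|y z|k kM kE] :=
    @additive_on_kernel_extends p A B phi gT pi p_pr gTp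
      (hom_extends_of_H1_injective p_pr H1_inj) _ l.
- apply: (cocycle_split_of_H2_surjective p_pr H2_surj) => //; exists g => y z yN zN.
  by apply: fN; rewrite inE pi1; apply: (derived_pseries_le le_nm).
- by rewrite !inE !pi1 => yN zN; apply: lM; apply: IH.
have kM' : additive_on (derived_pseries p B n) k.
  by move=> y z yN zN; apply: kM; rewrite inE pi1.
have := additive_on_derived_eq0 p_pr kM' phi_x.
rewrite kE ?lx => [/eqP|]; first by rewrite oner_eq0.
by apply/eqP; rewrite pi1.
Qed.

(** If phi(A) did not cover B/B^(n), its image would lie in a maximal subgroup M.
    As M contains the Frattini subgroup of the p-group B/B^(n), there would be a
    nonzero homomorphism B -> F_p vanishing on the preimage of M, hence on
    phi(A). *)
Lemma derived_surjective n : surjective (homology_map p phi 1) ->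
  forall y, exists x, ((phi x)^-1 * y)%g \in derived_pseries p B n.
Proof.
move=> H1_surj.
have [gT [pi [gTp pi_surj pi1]]] := derived_quotient_pgroup n p_pr fgB.
pose Q := [set g : gT | `[< exists x, pi (phi x) = g >]].
have Q_group : group_set Q.
  apply/group_setP; split=> [|_ _ /[!inE] /asboolP[x <-] /asboolP[y <-]].
    by rewrite inE; apply/asboolP; exists 1%g; rewrite !gmulf1.
  by apply/asboolP; exists (x * y)%g; rewrite !gmulfM.
have [QT|[M maxM QM]] := maximal_exists (finset.subsetT (group Q_group)).
  move=> y; have : pi y \in (group Q_group : {set gT}) by rewrite QT inE.
  rewrite inE => /asboolP[x xy]; exists x.
  by rewrite -pi1 gmulfM gmulfV xy mulVg.
have [y0 y0M] : exists y0, pi y0 \notin M.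
  have /subsetPn[g _ gM] : ~~ ([set: gT] \subset M).
    by case/maxgroupp/andP: maxM.
  by have [y0 y0g] := pi_surj g; exists y0; rewrite y0g.
have sub_M : ([set: gT]^`(1) <*> 'Mho^1([set: gT]) \subset M)%g.
  by rewrite -(Phi_joing gTp) Phi_sub_max.
have [|||||l [lM lK ly0]] :=
    @additive_separates p B (fun y => pi y \in M) y0 p_pr.
- by rewrite gmulf1 group1.
- by move=> y z yM zM; rewrite gmulfM gmulfV groupM ?groupV.
- move=> y z /=; apply: (fintype.subsetP sub_M); apply: (fintype.subsetP (joing_subl _ _)).
  by rewrite gmulfR mem_commg ?inE.
- move=> y /=; apply: (fintype.subsetP sub_M); apply: (fintype.subsetP (joing_subr _ _)).
  rewrite gmulfXn -(expn1 p) Mho_p_elt ?inE//.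
  by apply: mem_p_elt gTp _; rewrite inE.
- exact/negP.
have l0 : forall y, l y = 0.
  apply: (hom_eq0_of_H1_surjective H1_surj) => [y z _ _|x]; first exact: lM.
  by apply/lK/(fintype.subsetP QM); rewrite inE; apply/asboolP; exists x.
by move: ly0; rewrite l0 => /esym/eqP; rewrite oner_eq0.
Qed.
End DerivedSeriesMap.

Section DerivedQuotientMap.
Variables (p n : nat) (A B : groupType) (phi : {ghom A -> B}).
Let projA : A -> quot_group (derived_pseries p A n) := quot_proj _.
Let projB : B -> quot_group (derived_pseries p B n) := quot_proj _.

Lemma derived_quot_mapE x : derived_quot_map p phi n (projA x) = projB (phi x).
Proof. exact/quot_mapE/derived_pseries_morph. Qed.

Lemma injective_derived_quot_map :
  (forall x, phi x \in derived_pseries p B n -> x \in derived_pseries p A n) ->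
  injective (derived_quot_map p phi n).
Proof.
move=> pre x y; have xE : x = projA (repr x) by exact/esym/quot_projK.
have yE : y = projA (repr y) by exact/esym/quot_projK.
rewrite xE yE !derived_quot_mapE => /QuotientGroup.eqP xy.
by apply/QuotientGroup.eqP/pre; rewrite gmulfM gmulfV.
Qed.

Lemma surjective_derived_quot_map :
  (forall y, exists x, ((phi x)^-1 * y)%g \in derived_pseries p B n) ->
  surjective (derived_quot_map p phi n).
Proof.
move=> surj y; have [x xy] := surj (repr y); exists (projA x).
rewrite derived_quot_mapE; apply: etrans (quot_projK y).
exact/QuotientGroup.eqP.
Qed.
End DerivedQuotientMap.

Lemma bijective_of_injective_surjective (X Y : Type) (f : X -> Y) :
  injective f -> surjective f -> bijective f.
Proof.
by move=> f_inj /boolp.choice[g fg]; exists g => // x; apply: f_inj; rewrite fg.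
Qed.

Theorem theorem4p2 (p m : nat) (A B : groupType) (phi : {ghom A -> B})
    (hp : prime p)
    (hA : finitely_generated A)
    (hB : finitely_presented B)
    (hH2 : surjective (fun x : homology p A 2 =>
                         H2_proj m (homology_map p phi 2 x))) :
  (bijective (homology_map p phi 1) ->
     forall n : nat, (n <= m.+1)%N -> bijective (derived_quot_map p phi n))
  /\
  (injective (homology_map p phi 1) ->
     forall n : nat, (n <= m.+1)%N -> injective (derived_quot_map p phi n)).
Proof.
have fgB := finitely_presented_generated hB.
have inj : injective (homology_map p phi 1) -> forall n, (n <= m.+1)%N ->
    injective (derived_quot_map p phi n).
  move=> H1_inj n n_m; apply: injective_derived_quot_map.
  exact: derived_preimage hp fgB hH2 H1_inj n n_m.
split=> // H1_bij n n_m; apply: bijective_of_injective_surjective.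
  exact: inj (bij_inj H1_bij) n n_m.
apply: surjective_derived_quot_map; apply: derived_surjective => // y.
by have [g _ gK] := H1_bij; exists (g y).
Qed.
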